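(* Let $(V,|0\rangle,T,Y,\mathcal{S})$ be a braided state-field correspondence such that $Y(z)\mathcal{S}(z)=Y^{op}(z)$, where $Y^{op}(z)(u\otimes v)=e^{zT}Y(-z)(v\otimes u)$. Then, for all $a,b\in V$, $$-b_{-\lambda-T}\,a=\sum_ia^i_{(\lambda,f_i)}b^i,$$ where $\mathcal{S}(z)(a\otimes b)=\sum_if_i(z)\,a^i\otimes b^i$.
   Context: $\mathbb{K}$ is a field of characteristic zero. A topologically free $\mathbb{K}[[h]]$-module is one isomorphic to $W[[h]]$ for a $\mathbb{K}$-vector space $W$; $U[[h]]\hat\otimes W[[h]]:=(U\otimes W)[[h]]$. $V_h((z))$ is the set of $a(z)\in V[[z,z^{-1}]]$ such that $a(z)\in V((z))$ modulo $h^M$ for every $M\ge0$. $\mathrm{Res}_z$ is the coefficient of $z^{-1}$. A braided state-field correspondence $(V,|0\rangle,T,Y,\mathcal{S})$ consists of: a topologically free $\mathbb{K}[[h]]$-module $V$ with a nonzero vector $|0\rangle$ and a $\mathbb{K}[[h]]$-linear $T:V\to V$ with $T|0\rangle=0$; a $\mathbb{K}[[h]]$-linear map $Y:V\hat\otimes V\to V_h((z))$, written $Y(z)(a\otimes b)=Y(a,z)b=\sum_{n\in\mathbb{Z}}a_{(n)}b\,z^{-n-1}$, with $Y(z)(|0\rangle\otimes v)=v$, $Y(z)(v\otimes|0\rangle)\in v+V[[z]]z$ for all $v\in V$, and $\partial_zY(z)=TY(z)-Y(z)(1\otimes T)=Y(z)(T\otimes1)$; and a braiding, i.e. a $\mathbb{K}[[h]]$-linear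 map $\mathcal{S}(z):V\hat\otimes V\to V\hat\otimes V\hat\otimes(\mathbb{K}((z))[[h]])$ with $\mathcal{S}=1+O(h)$. $Y(z)$ is extended linearly to $V\hat\otimes V\hat\otimes(\mathbb{K}((z))[[h]])$. The decomposition of $\mathcal{S}(z)(a\otimes b)$ has $f_i\in\mathbb{K}((z))[[h]]$ and is understood as an $h$-adically convergent sum. For $f\in\mathbb{K}((z))[[h]]$ the $(\lambda,f)$-product is $a_{(\lambda,f)}b=\mathrm{Res}_z\,e^{\lambda z}f(z)Y(z)(a\otimes b)$, with values in $V\otimes\mathbb{K}[\lambda][[h]]$ ($h$-adically completed: polynomial in $\lambda$ with coefficients in $V$ modulo each $h^M$), and $a_\lambda b=a_{(\lambda,1)}b=\sum_{n\ge0}\frac{\lambda^n}{n!}a_{(n)}b$. In $b_{-\lambda-T}a$, $T$ acts on the products: $b_{-\lambda-T}a=\sum_{n\ge0}\frac{(-\lambda-T)^n}{n!}(b_{(n)}a)$. *)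

(* Defs.v *)
From HB Require Import structures.
From mathcomp Require Import all_boot all_order all_algebra.
From mathcomp Require Import generic_quotient ring_quotient finmap.
From mathcomp Require Import boolp classical_sets functions.
From mathcomp.multinomials Require Import freeg.
From mathcomp Require Import zify.

Set Implicit Arguments.
Unset Strict Implicit.
Unset Printing Implicit Defensive.

Import Order.TTheory GRing.Theory Num.Theory.
Local Open Scope ring_scope.

(** * Formal power series in h *)

(* [fps W] is W[[h]]; [f n] is the coefficient of h^n.  The ring structure is
   the Cauchy product, not the pointwise one available on [nat -> K]. *)
Definition fps (W : Type) := nat -> W.

HB.instance Definition _ (W : choiceType) := Choice.copy (fps W) (nat -> W).
HB.instance Definition _ (W : zmodType) :=
  GRing.Zmodule.copy (fps W) (nat -> W).

Section FpsRing.
Variable K : comNzRingType.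
Implicit Types f g k : fps K.

Definition fps_one : fps K := fun n => (n == 0%N)%:R.
Definition fps_mul f g : fps K := fun n => \sum_(i < n.+1) f i * g (n - i)%N.

Lemma fps_mulE f g n : fps_mul f g n = (\poly_(i < n.+1) f i * \poly_(i < n.+1) g i)`_n.
Proof.
rewrite coefM; apply: eq_bigr => i _.
by rewrite !coef_poly ltn_ord ltnS leq_subr.
Qed.

Fact fps_mulC : commutative fps_mul.
Proof. by move=> f g; apply: funext => n; rewrite !fps_mulE mulrC. Qed.

Fact fps_mul1 : left_id fps_one fps_mul.
Proof.
move=> f; apply: funext => n; rewrite /fps_mul big_ord_recl /= /fps_one eqxx.
rewrite mul1r subn0 big1 ?addr0 // => i _; by rewrite /= mul0r.
Qed.

Fact fps_mulA : associative fps_mul.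
Proof.
move=> f g k; apply: funext => n.
pose P (u : fps K) := \poly_(i < n.+1) u i.
have PE (u v : fps K) m : (m <= n)%N -> fps_mul u v m = (P u * P v)`_m.
  move=> mn; rewrite coefM; apply: eq_bigr => i _.
  have im : (i <= m)%N by rewrite -ltnS ltn_ord.
  by rewrite !coef_poly !ltnS (leq_trans im mn) (leq_trans (leq_subr _ _) mn).
transitivity ((P f * (P g * P k))`_n).
  rewrite coefM; apply: eq_bigr => i _.
  by rewrite -PE ?leq_subr // coef_poly ltn_ord.
rewrite mulrA coefM; apply: eq_bigr => i _.
by rewrite -PE -1?ltnS ?ltn_ord // coef_poly ltnS leq_subr.
Qed.

Fact fps_mulDl : left_distributive fps_mul +%R.
Proof.
move=> f g k; apply: funext => n; rewrite /fps_mul.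
transitivity (\sum_(i < n.+1) (f i * k (n - i)%N + g i * k (n - i)%N)).
  by apply: eq_bigr => i _; rewrite -mulrDl.
by rewrite big_split.
Qed.

Fact fps_one_neq0 : fps_one != 0.
Proof.
apply/eqP => /(congr1 (fun f : fps K => f 0%N)) /eqP.
by rewrite /fps_one eqxx (negPf (oner_neq0 _)).
Qed.

HB.instance Definition _ := GRing.Zmodule_isComNzRing.Build (fps K)
  fps_mulA fps_mulC fps_mul1 fps_mulDl fps_one_neq0.

Definition hvar : fps K := fun n => (n == 1%N)%:R.
Definition hcst (c : K) : fps K := fun n => if n == 0%N then c else 0.

Section FpsMod.
Variable W : lmodType K.
Implicit Types v w : fps W.

Definition fps_scale f v : fps W := fun n => \sum_(i < n.+1) f i *: v (n - i)%N.

Fact fps_scaleA f g v : fps_scale f (fps_scale g v) = fps_scale (f * g) v.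
Proof.
apply: funext => n; rewrite /fps_scale.
pose G m i := (f i * g (m - i)%N) *: v (n - m)%N.
transitivity (\sum_(0 <= m < n.+1) \sum_(0 <= i < m.+1) G m i); last first.
  rewrite big_mkord; apply: eq_bigr => m _.
  by rewrite big_mkord -scaler_suml.
transitivity (\sum_(0 <= i < n.+1) \sum_(i <= m < n.+1) G m i).
  rewrite big_mkord; apply: eq_bigr => i _; have ln := ltn_ord i.
  rewrite (_ : index_iota i _ = index_iota (0 + i) n.+1) // big_addn big_mkord.
  rewrite scaler_sumr subSn //.
  by apply: eq_bigr => j _; rewrite scalerA /G addnK -subnDA addnC.
under eq_bigr => i _ do rewrite (big_nat_widenl _ 0) //.
under [RHS]eq_big_nat => m /andP[_ mn] do rewrite (big_nat_widen _ _ n.+1) //.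
by rewrite (exchange_big_dep_nat xpredT).
Qed.

Fact fps_scale1 : left_id 1 fps_scale.
Proof.
move=> v; apply: funext => n; rewrite /fps_scale big_ord_recl /= subn0.
by rewrite big1 => [|i _]; rewrite [X in X *: _]/GRing.one /= ?addr0 ?scale1r ?scale0r.
Qed.

Fact fps_scaleDr : right_distributive fps_scale +%R.
Proof.
move=> f v w; apply: funext => n; rewrite /fps_scale -[RHS]big_split /=.
by apply: eq_bigr => i _; rewrite -scalerDr.
Qed.

Fact fps_scaleDl v : {morph fps_scale^~ v : f g / f + g}.
Proof.
move=> f g; apply: funext => n; rewrite /fps_scale -[RHS]big_split /=.
by apply: eq_bigr => i _; rewrite -scalerDl.
Qed.

HB.instance Definition _ := GRing.Zmodule_isLmodule.Build (fps K) (fps W)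
  fps_scaleA fps_scale1 fps_scaleDr fps_scaleDl.
End FpsMod.

Lemma hvarXE M f n : (hvar ^+ M * f) n = if (n < M)%N then 0 else f (n - M)%N.
Proof.
elim: M n => [|M IH] n; first by rewrite expr0 mul1r subn0.
rewrite exprS -mulrA [LHS]/(fps_mul _ _ n) /fps_mul big_ord_recl {1}/hvar mul0r add0r.
case: n => [|n]; first by rewrite big_ord0.
rewrite big_ord_recl [X in X * _]/hvar /= /bump /= mul1r addn0 subn1 IH ltnS subSS.
by rewrite big1 ?addr0 // => i _; rewrite [X in X * _]/hvar /= mul0r.
Qed.

Lemma fps_hdiv M f : (forall n, (n < M)%N -> f n = 0) -> exists g, f = hvar ^+ M * g.
Proof.
move=> fM; exists (fun n => f (n + M)%N); apply: funext => n; rewrite hvarXE.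
by case: ltnP => [/fM|Mn] //; rewrite subnK.
Qed.
End FpsRing.

Arguments hvar {K}.

(** * The h-adic topology *)

Section HAdic.
Variables (K : comNzRingType) (X : lmodType (fps K)).

(* x lies in h^M X *)
Definition hdiv (M : nat) (x : X) : Prop := exists y, x = hvar ^+ M *: y.

Definition has_hsum (I : choiceType) (F : I -> X) (s : X) : Prop :=
  forall M, exists A : {fset I}, forall B : {fset I}, (A `<=` B)%fset ->
    hdiv M (s - \sum_(i <- B) F i).

(* The sum is unique when X is h-adically separated; 0 if F is not summable. *)
Definition hsum (I : choiceType) (F : I -> X) : X :=
  xget 0 [set s | has_hsum F s]%classic.

Lemma hdiv0 M : hdiv M 0.
Proof. by exists 0; rewrite scaler0. Qed.

Lemma hdivP M c x y : hdiv M x -> hdiv M y -> hdiv M (c *: x + y).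
Proof.
move=> [u ->] [v ->]; exists (c *: u + v).
by rewrite scalerDr !scalerA mulrC.
Qed.

Lemma hdivD M x y : hdiv M x -> hdiv M y -> hdiv M (x + y).
Proof. by move=> xM yM; rewrite -[x]scale1r; exact: hdivP. Qed.

Lemma hdivZ M c x : hdiv M x -> hdiv M (c *: x).
Proof. by move=> xM; rewrite -[_ *: _]addr0; apply: hdivP xM (hdiv0 _). Qed.

Lemma hdiv_sum (I : Type) (r : seq I) M (F : I -> X) :
  (forall i, hdiv M (F i)) -> hdiv M (\sum_(i <- r) F i).
Proof.
by move=> FM; elim/big_ind: _ => //; [exact: hdiv0|exact: hdivD].
Qed.

Lemma hdiv_hsum (I : choiceType) M (F : I -> X) :
  (forall i, hdiv M (F i)) -> hdiv M (hsum F).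
Proof.
move=> FM; rewrite /hsum; case: xgetP => [s _ sF|_]; last exact: hdiv0.
have [A /(_ A (fsubset_refl A)) AM] := sF M.
by rewrite -[s](subrK (\sum_(i <- A) F i)); apply: hdivD => //; exact: hdiv_sum.
Qed.
End HAdic.

Lemma hdiv_lin (K : comNzRingType) (X Y : lmodType (fps K)) M
  (f : {linear X -> Y}) x : hdiv M x -> hdiv M (f x).
Proof. by case=> u ->; exists (f u); rewrite linearZ. Qed.

(** * Algebraic tensor product over K *)

Section Tensor.
Variables (K : comNzRingType) (U W : lmodType K).

Local Notation F := {freeg (U * W)%type / K}.

Definition tgen (u : U) (w : W) : F := [freeg [:: (1, (u, w))]].

(* The submodule generated by the bilinearity relations. *)
Inductive tnull : F -> Prop :=
| tnull0 : tnull 0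
| tnullP c x y : tnull x -> tnull y -> tnull (c *: x + y)
| tnullDl u u' w : tnull (tgen (u + u') w - tgen u w - tgen u' w)
| tnullDr u w w' : tnull (tgen u (w + w') - tgen u w - tgen u w')
| tnullZl c u w : tnull (tgen (c *: u) w - c *: tgen u w)
| tnullZr c u w : tnull (tgen u (c *: w) - c *: tgen u w).

Definition tnull_pred : {pred F} := fun x => `[< tnull x >].

Fact tnull_submod : submod_closed tnull_pred.
Proof.
split; first exact/asboolP/tnull0.
by move=> c x y /asboolP xn /asboolP yn; apply/asboolP; apply: tnullP.
Qed.

HB.instance Definition _ :=
  GRing.isSubmodClosed.Build K F tnull_pred (GRing.submod_closed_semi tnull_submod).
HB.instance Definition _ :=
  GRing.isOppClosed.Build F tnull_pred (GRing.zmod_closedN (GRing.submod_closedB tnull_submod)).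

Definition tens := (Quotient.quot tnull_pred).
HB.instance Definition _ := Choice.on tens.
HB.instance Definition _ := GRing.Zmodule.on tens.

Definition tens_class (x : F) : tens := \pi_(Quotient.quot tnull_pred)%qT x.
Definition tens_repr (t : tens) : F := repr (t : (Quotient.quot tnull_pred)).

Lemma tens_reprK : cancel tens_repr tens_class.
Proof. exact: reprK. Qed.

Lemma tens_classP x y : tens_class x = tens_class y <-> tnull (x - y).
Proof.
rewrite /tens_class; split.
  by move/eqP; rewrite -Quotient.idealrBE => /asboolP.
by move=> /asboolP xy; apply/eqP; rewrite -Quotient.idealrBE.
Qed.

Fact tens_class_zmod : zmod_morphism tens_class.
Proof. exact: pi_is_zmod_morphism. Qed.
HB.instance Definition _ :=
  GRing.isZmodMorphism.Build F tens tens_class tens_class_zmod.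

Definition tens_scale (c : K) (t : tens) : tens := tens_class (c *: tens_repr t).

Lemma tens_scaleE c x : tens_scale c (tens_class x) = tens_class (c *: x).
Proof.
apply/tens_classP; rewrite -scalerBr -[_ *: _]addr0.
by apply: tnullP tnull0; apply/tens_classP; exact: tens_reprK.
Qed.

Fact tens_scaleA a b t : tens_scale a (tens_scale b t) = tens_scale (a * b) t.
Proof. by rewrite -[t]tens_reprK !tens_scaleE scalerA. Qed.

Fact tens_scale1 : left_id 1 tens_scale.
Proof. by move=> t; rewrite -[t]tens_reprK tens_scaleE scale1r. Qed.

Fact tens_scaleDr : right_distributive tens_scale +%R.
Proof.
move=> c s t; rewrite -[s]tens_reprK -[t]tens_reprK -raddfD !tens_scaleE.
by rewrite scalerDr raddfD.
Qed.

Fact tens_scaleDl t : {morph tens_scale^~ t : a b / a + b}.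
Proof. by move=> a b; rewrite -[t]tens_reprK !tens_scaleE scalerDl raddfD. Qed.

HB.instance Definition _ := GRing.Zmodule_isLmodule.Build K tens
  tens_scaleA tens_scale1 tens_scaleDr tens_scaleDl.

Definition tpure (u : U) (w : W) : tens := tens_class (tgen u w).

(* The linear map on U (x) W induced by a K-bilinear B, for a target that is a
   K[[h]]-module. *)
Definition tlift (X : lmodType (fps K)) (B : U -> W -> X) (t : tens) : X :=
  \sum_(p <- dom (tens_repr t)) hcst (coeff p (tens_repr t)) *: B p.1 p.2.
End Tensor.

(** * Topologically free modules and their completed tensor product *)

(* A K[[h]]-module with an isomorphism onto W[[h]], W = [tf_base]. *)
Record topFree (K : comNzRingType) := TopFree {
  tf_sort :> lmodType (fps K);
  tf_base : lmodType K;
  tf_iso : {linear tf_sort -> fps tf_base};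
  tf_inv : fps tf_base -> tf_sort;
  tf_isoK : cancel tf_iso tf_inv;
  tf_invK : cancel tf_inv tf_iso
}.

Definition fps_free (K : comNzRingType) (W : lmodType K) : topFree K :=
  @TopFree K (fps W) W idfun id (fun=> erefl) (fun=> erefl).

(* w in W, seen as the constant series w in V = W[[h]]. *)
Definition tf_cst (K : comNzRingType) (V : topFree K) (w : tf_base V) : V :=
  tf_inv (fun n => if n == 0%N then w else 0).

(* U[[h]] (x)^ W[[h]] is (U (x) W)[[h]]. *)
Section CTens.
Variables (K : comNzRingType) (U V : topFree K).

Definition ctens : topFree K := fps_free (tens (tf_base U) (tf_base V)).

Definition ctpure (u : U) (v : V) : ctens :=
  fun n => \sum_(i < n.+1) tpure (tf_iso U u i) (tf_iso V v (n - i)%N).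

(* The continuous linear map on [ctens] induced by a K[[h]]-bilinear B. *)
Definition clift (X : lmodType (fps K)) (B : U -> V -> X) (x : ctens) : X :=
  hsum (fun n : nat =>
    hvar ^+ n *: tlift (fun u w => B (tf_cst u) (tf_cst w)) (x n)).
End CTens.

Arguments ctens {K} U V.

Declare Scope ctens_scope.
Delimit Scope ctens_scope with CT.
Notation "U ^⊗ V" := (ctens U V) (at level 40, left associativity) : ctens_scope.
Notation "u ⊗ v" := (ctpure u v) (at level 40, left associativity) : ctens_scope.
Local Open Scope ctens_scope.

Definition ctmap (K : comNzRingType) (U V U' V' : topFree K)
    (f : U -> U') (g : V -> V') : U ^⊗ V -> U' ^⊗ V' :=
  clift (fun u v => f u ⊗ g v).

Definition ctswap (K : comNzRingType) (U V : topFree K) : U ^⊗ V -> V ^⊗ U :=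
  clift (fun u v => v ⊗ u).

(** * Series in z *)

(* K((z)) *)
Section Laurent.
Variable K : comNzRingType.

Definition laurent_pred : {pred int -> K^o} :=
  fun f => `[< exists N : int, forall m, m < N -> f m = 0 >].

Fact laurent_submod : submod_closed laurent_pred.
Proof.
split; first by apply/asboolP; exists 0.
move=> c f g /asboolP[N fN] /asboolP[M gM]; apply/asboolP.
exists (Num.min N M) => m; rewrite lt_min => /andP[mN mM].
by rewrite [LHS]/= -[LHS]/(c *: f m + g m) fN // gM // scaler0 addr0.
Qed.
HB.instance Definition _ :=
  GRing.isSubmodClosed.Build K (int -> K^o) laurent_pred
    (GRing.submod_closed_semi laurent_submod).
HB.instance Definition _ :=
  GRing.isOppClosed.Build (int -> K^o) laurent_pred
    (GRing.zmod_closedN (GRing.submod_closedB laurent_submod)).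

Record laurent := Laurent {
  laurent_coef :> int -> K^o; _ : laurent_coef \in laurent_pred }.
HB.instance Definition _ := [isSub for laurent_coef].
HB.instance Definition _ := [Choice of laurent by <:].
HB.instance Definition _ := [SubChoice_isSubZmodule of laurent by <:].
HB.instance Definition _ := [SubZmodule_isSubLmodule of laurent by <:].

Fact laurent1_subproof : (fun m => (m == 0)%:R : K^o) \in laurent_pred.
Proof. by apply/asboolP; exists 0 => m m0; rewrite lt_eqF. Qed.
Definition laurent1 := Laurent laurent1_subproof.
End Laurent.

(* K((z))[[h]] *)
Definition hlaurent (K : comNzRingType) : topFree K := fps_free (laurent K).

Definition hlaurent1 (K : comNzRingType) : hlaurent K := tf_cst (laurent1 K : tf_base (hlaurent K)).

(* The coefficient of z^j in f(z), as an element of K[[h]]. *)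
Definition zcoef (K : comNzRingType) (f : hlaurent K) (j : int) : fps K :=
  fun n => (f n : laurent K) j.

(* V_h((z)); [g m] is the coefficient of z^m. *)
Section VLaurent.
Variables (K : comNzRingType) (V : lmodType (fps K)).

Definition vlaurent_pred : {pred int -> V} :=
  fun g => `[< forall M, exists N : int, forall m, m < N -> hdiv M (g m) >].

Fact vlaurent_submod : submod_closed vlaurent_pred.
Proof.
split; first by apply/asboolP => M; exists 0 => m _; exact: hdiv0.
move=> c f g /asboolP fP /asboolP gP; apply/asboolP => M.
have [[N fN] [N' gN']] := (fP M, gP M); exists (Num.min N N') => m.
by rewrite lt_min => /andP[mN mN']; apply: hdivP; [exact: fN|exact: gN'].
Qed.
HB.instance Definition _ :=
  GRing.isSubmodClosed.Build (fps K) (int -> V) vlaurent_pred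
    (GRing.submod_closed_semi vlaurent_submod).
HB.instance Definition _ :=
  GRing.isOppClosed.Build (int -> V) vlaurent_pred
    (GRing.zmod_closedN (GRing.submod_closedB vlaurent_submod)).

Record vlaurent := VLaurent {
  vlaurent_coef :> int -> V; vlaurent_subproof : vlaurent_coef \in vlaurent_pred }.
HB.instance Definition _ := [isSub for vlaurent_coef].
HB.instance Definition _ := [Choice of vlaurent by <:].
HB.instance Definition _ := [SubChoice_isSubZmodule of vlaurent by <:].
HB.instance Definition _ := [SubZmodule_isSubLmodule of vlaurent by <:].

Lemma vlaurentP (g : vlaurent) M :
  exists N : int, forall m, m < N -> hdiv M (g m).
Proof. by have /asboolP/(_ M) := vlaurent_subproof g. Qed.

(* V (x) K[lambda][[h]], completed: [p n] is the coefficient of lambda^n. *)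
Definition vpoly_pred : {pred nat -> V} :=
  fun p => `[< forall M, exists N : nat, forall n, (N <= n)%N -> hdiv M (p n) >].

Fact vpoly_submod : submod_closed vpoly_pred.
Proof.
split; first by apply/asboolP => M; exists 0%N => m _; exact: hdiv0.
move=> c f g /asboolP fP /asboolP gP; apply/asboolP => M.
have [[N fN] [N' gN']] := (fP M, gP M); exists (maxn N N') => m.
by rewrite geq_max => /andP[mN mN']; apply: hdivP; [exact: fN|exact: gN'].
Qed.
HB.instance Definition _ :=
  GRing.isSubmodClosed.Build (fps K) (nat -> V) vpoly_pred
    (GRing.submod_closed_semi vpoly_submod).
HB.instance Definition _ :=
  GRing.isOppClosed.Build (nat -> V) vpoly_pred
    (GRing.zmod_closedN (GRing.submod_closedB vpoly_submod)).

Record vpoly := VPoly {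
  vpoly_coef :> nat -> V; vpoly_subproof : vpoly_coef \in vpoly_pred }.
HB.instance Definition _ := [isSub for vpoly_coef].
HB.instance Definition _ := [Choice of vpoly by <:].
HB.instance Definition _ := [SubChoice_isSubZmodule of vpoly by <:].
HB.instance Definition _ := [SubZmodule_isSubLmodule of vpoly by <:].

Lemma vpolyP (p : vpoly) M :
  exists N : nat, forall n, (N <= n)%N -> hdiv M (p n).
Proof. by have /asboolP/(_ M) := vpoly_subproof p. Qed.
End VLaurent.

Section Operations.
Variables (K : fieldType) (V : lmodType (fps K)).
Implicit Types (g : vlaurent V) (f : hlaurent K) (T : {linear V -> V}).

(* f(z) g(z) *)
Fact vl_mul_subproof f g :
  (fun m => hsum (fun j : int => zcoef f j *: g (m - j))) \in @vlaurent_pred _ V.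
Proof.
apply/asboolP => M; have [N gN] := vlaurentP g M.
have [N' fN'] : exists N' : int, forall j, j < N' -> forall n, (n < M)%N -> zcoef f j n = 0.
  elim: M {N gN} => [|M [N IH]]; first by exists 0.
  have /asboolP[N' fN'] := valP (f M : laurent K).
  exists (Num.min N N') => j; rewrite lt_min => /andP[jN jN'] n.
  rewrite ltnS leq_eqVlt => /predU1P[->|nM]; [exact: fN'|exact: IH].
exists (N + N') => m mN; apply: hdiv_hsum => j.
have [jN'|N'j] := ltP j N'; last first.
  by apply/hdivZ/gN; rewrite ltrBlDr (lt_le_trans mN) // lerD2l.
have [u ->] := fps_hdiv (fN' j jN').
by exists (u *: g (m - j)); rewrite scalerA.
Qed.
Definition vl_mul f g : vlaurent V := VLaurent (vl_mul_subproof f g).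

(* d/dz g(z) *)
Fact vl_deriv_subproof g :
  (fun m => g (m + 1) *~ (m + 1)) \in @vlaurent_pred _ V.
Proof.
apply/asboolP => M; have [N gN] := vlaurentP g M.
exists (N - 1) => m; rewrite ltrBrDr => mN.
by rewrite -scaler_int; apply/hdivZ/gN.
Qed.
Definition vl_deriv g : vlaurent V := VLaurent (vl_deriv_subproof g).

(* T g(z) *)
Fact vl_map_subproof T g : (fun m => T (g m)) \in @vlaurent_pred _ V.
Proof.
apply/asboolP => M; have [N gN] := vlaurentP g M.
by exists N => m mN; apply/hdiv_lin/gN.
Qed.
Definition vl_map T g : vlaurent V := VLaurent (vl_map_subproof T g).

(* g(-z) *)
Fact vl_opp_subproof g : (fun m => (-1) ^+ absz m *: g m) \in @vlaurent_pred _ V.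
Proof.
apply/asboolP => M; have [N gN] := vlaurentP g M.
by exists N => m mN; apply/hdivZ/gN.
Qed.
Definition vl_opp g : vlaurent V := VLaurent (vl_opp_subproof g).

Lemma hdiv_iter M n T x : hdiv M x -> hdiv M (iter n T x).
Proof. by move=> xM; elim: n => //= n; exact: hdiv_lin. Qed.

(* e^{zT} g(z) *)
Fact vl_exp_subproof T g :
  (fun m => hsum (fun k : nat =>
     hcst (k`!%:R^-1 : K) *: iter k T (g (m - k%:Z)))) \in @vlaurent_pred _ V.
Proof.
apply/asboolP => M; have [N gN] := vlaurentP g M.
exists N => m mN; apply: hdiv_hsum => k; apply/hdivZ/hdiv_iter/gN.
by rewrite ltrBlDr ltr_wpDr.
Qed.
Definition vl_exp T g : vlaurent V := VLaurent (vl_exp_subproof T g).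

(* Res_z e^{lambda z} g(z) *)
Fact lres_subproof g :
  (fun n : nat => hcst (n`!%:R^-1 : K) *: g (- n.+1%:Z)) \in @vpoly_pred _ V.
Proof.
apply/asboolP => M; have [N gN] := vlaurentP g M.
exists (absz N) => n Nn; apply/hdivZ/gN.
lia.
Qed.
Definition lres g : vpoly V := VPoly (lres_subproof g).

(* p(- lambda - T), where T acts on the coefficients of p *)
Fact vp_subst_subproof T (p : vpoly V) :
  (fun k => hsum (fun n : nat =>
     hcst ((-1) ^+ n * 'C(n, k)%:R : K) *: iter (n - k) T (p n))) \in @vpoly_pred _ V.
Proof.
apply/asboolP => M; have [N pN] := vpolyP p M.
exists N => k Nk; apply: hdiv_hsum => n.
have [kn|nk] := leqP k n; first by apply/hdivZ/hdiv_iter/pN/(leq_trans Nk).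
have -> : hcst ((-1) ^+ n * 'C(n, k)%:R : K) = 0.
  by apply: funext => i; rewrite /hcst bin_small // mulr0 if_same.
by rewrite scale0r; exact: hdiv0.
Qed.
Definition vp_subst T (p : vpoly V) : vpoly V := VPoly (vp_subst_subproof T p).
End Operations.

(** * Braided state-field correspondences *)

(* [bsf_Y x m] is the coefficient of z^m in Y(z)(x), so that
   a_(n) b = bsf_Y (a ⊗ b) (- n - 1). *)
Record braided_sfc (K : fieldType) (V : topFree K) := BraidedSFC {
  bsf_vac : V;
  bsf_T : {linear V -> V};
  bsf_Y : {linear V ^⊗ V -> vlaurent V};
  bsf_S : {linear V ^⊗ V -> V ^⊗ V ^⊗ hlaurent K};
  bsf_vac_neq0 : bsf_vac != 0;
  bsf_T_vac : bsf_T bsf_vac = 0;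
  bsf_Y_vacl : forall (v : V) (m : int),
    bsf_Y (bsf_vac ⊗ v) m = if m == 0 then v else 0;
  bsf_Y_vacr : forall (v : V) (m : int), m <= 0 ->
    bsf_Y (v ⊗ bsf_vac) m = if m == 0 then v else 0;
  bsf_Y_deriv : forall x : V ^⊗ V,
    vl_deriv (bsf_Y x) = vl_map bsf_T (bsf_Y x) - bsf_Y (ctmap id bsf_T x);
  bsf_Y_transl : forall x : V ^⊗ V,
    vl_deriv (bsf_Y x) = bsf_Y (ctmap bsf_T id x);
  bsf_S1 : forall x : V ^⊗ V, hdiv 1 (bsf_S x - x ⊗ hlaurent1 K)
}.

Section BraidedSFC.
Variables (K : fieldType) (V : topFree K) (B : braided_sfc V).

(* The linear extension of Y(z): x ⊗ f(z) |-> f(z) Y(z)(x). *)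
Definition bsf_Yext : V ^⊗ V ^⊗ hlaurent K -> vlaurent V :=
  clift (fun x f => vl_mul f (bsf_Y B x)).

(* e^{zT} Y(-z) composed with the flip. *)
Definition bsf_Yop (x : V ^⊗ V) : vlaurent V :=
  vl_exp (bsf_T B) (vl_opp (bsf_Y B (ctswap x))).

(* a_(lambda, f) b *)
Definition lfprod (f : hlaurent K) (a b : V) : vpoly V :=
  lres (vl_mul f (bsf_Y B (a ⊗ b))).

(* a_lambda b *)
Definition lprod (a b : V) : vpoly V := lfprod (hlaurent1 K) a b.
End BraidedSFC.

(* Main.v *)
(* Put L := Res_z e^{lambda z} o Y(z), defined on V (x) V (x) K((z))[[h]].  It is
   K[[h]]-linear, hence h-adically continuous, and it maps a (x) b (x) f to the
   (lambda, f)-product.  Applied to S(z)(a (x) b) it therefore yields the right-hand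
   side, and since Y S = Y^op it also yields Res_z e^{lambda z} e^{zT} Y(-z)(b (x) a),
   which is - b_{-lambda-T} a by the binomial theorem.
   The induced map [clift] on a completed tensor product is well defined and linear
   only for targets that are h-adically separated and complete, and [hsum] returns a
   junk value otherwise; V_h((z)) has these properties because V is topologically
   free. *)
From HB Require Import structures.
Require Import Defs.
From mathcomp Require Import all_order finmap.
From mathcomp Require Import boolp classical_sets functions.
From mathcomp Require Import freeg.
From mathcomp Require Import zify ring.
From mathcomp Require Import all_boot all_algebra.

Set Implicit Arguments.
Unset Strict Implicit.
Unset Printing Implicit Defensive.

Import Order.TTheory GRing.Theory Num.Theory.
Local Open Scope ring_scope.
Local Open Scope ctens_scope.

(** * Summable families *)

Section HAdicSums.
Variables (K : comNzRingType) (X : lmodType (fps K)).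

Definition hseparated := forall x : X, (forall M, hdiv M x) -> x = 0.

Definition htorsionfree := forall x : X, hvar *: x = 0 -> x = 0.

(** The Cauchy form of convergence: no sum is named, so the condition can be checked before a sum is
    known to exist. *)
Definition hsummable (I : choiceType) (F : I -> X) :=
  forall M, exists A : {fset I}, forall i, i \notin A -> hdiv M (F i).

Definition hcomplete :=
  forall (I : choiceType) (F : I -> X), hsummable F -> exists s, has_hsum F s.

Lemma hdivN M (x : X) : hdiv M x -> hdiv M (- x).
Proof. by rewrite -scaleN1r; exact: hdivZ. Qed.

Lemma hdivB M (x y : X) : hdiv M x -> hdiv M y -> hdiv M (x - y).
Proof. by move=> xM yM; apply: hdivD => //; exact: hdivN. Qed.

Lemma hdiv_le M N (x : X) : (M <= N)%N -> hdiv N x -> hdiv M x.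
Proof.
move=> /subnKC<- [y ->]; exists (hvar ^+ (N - M) *: y).
by rewrite scalerA -exprD.
Qed.

(** The sum over [A] is a sum over [B] with zeros inserted, so only terms outside [A] survive in the
    difference. *)
Lemma hdiv_big_fset_sub (I : choiceType) (F : I -> X) M (A B : {fset I}) :
  (forall i, i \notin A -> hdiv M (F i)) -> (A `<=` B)%fset ->
  hdiv M (\sum_(i <- B) F i - \sum_(i <- A) F i).
Proof.
move=> FA AB.
have -> : \sum_(i <- A) F i = \sum_(i <- B) (if i \in A then F i else 0).
  rewrite -(big_fset_incl _ AB) => [|i _ /negPf-> //].
  by rewrite big_seq [RHS]big_seq; apply: eq_bigr => i ->.
rewrite -sumrB; apply: hdiv_sum => i.
by case: ifPn => [_|/FA]; rewrite ?subrr ?subr0 //; exact: hdiv0.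
Qed.

(** Convergence supplies some finite set [C]; passing through the union with [C] lets any [A] with
    divisible terms outside it approximate [s] modulo h^M. *)
Lemma has_hsum_tail (I : choiceType) (F : I -> X) s M (A : {fset I}) :
  has_hsum F s -> (forall i, i \notin A -> hdiv M (F i)) ->
  hdiv M (s - \sum_(i <- A) F i).
Proof.
move=> /(_ M)[C sC] FA.
rewrite -[s](subrK (\sum_(i <- (A `|` C)%fset) F i)) -addrA; apply: hdivD.
  by apply: sC; exact: fsubsetUr.
by apply: hdiv_big_fset_sub => //; exact: fsubsetUl.
Qed.

(** A working criterion for convergence: one finite set for each M replaces the condition on all its
    supersets. *)
Lemma has_hsumI (I : choiceType) (F : I -> X) s :
  (forall M, exists2 A : {fset I}, hdiv M (s - \sum_(i <- A) F i) &
    forall i, i \notin A -> hdiv M (F i)) -> has_hsum F s.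
Proof.
move=> sF M; have [A sA FA] := sF M; exists A => C AC.
rewrite -[s](subrK (\sum_(i <- A) F i)) -addrA; apply: hdivD => //.
by rewrite -opprB; apply/hdivN/hdiv_big_fset_sub.
Qed.

(** Adjoining [i] to [A] changes the partial sum by [F i], while both partial sums agree with [s]
    modulo h^M. *)
Lemma has_hsum_summable (I : choiceType) (F : I -> X) s :
  has_hsum F s -> hsummable F.
Proof.
move=> sF M; have [A sA] := sF M; exists A => i iA.
have := hdivB (sA _ (fsubset_refl A)) (sA _ (fsubsetUr [fset i]%fset A)).
by rewrite big_fsetU1 //= opprB [F i + _]addrC !addrA subrK addrAC subrr add0r.
Qed.

Lemma has_hsum_unique (I : choiceType) (F : I -> X) s t :
  hseparated -> has_hsum F s -> has_hsum F t -> s = t.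
Proof.
move=> sep sF tF; apply/eqP; rewrite -subr_eq0; apply/eqP/sep => M.
have [A FA] := has_hsum_summable sF M.
have := hdivB (has_hsum_tail sF FA) (has_hsum_tail tF FA).
by rewrite opprB addrA subrK.
Qed.

Lemma hsumE (I : choiceType) (F : I -> X) s :
  hseparated -> has_hsum F s -> hsum F = s.
Proof.
move=> sep sF; rewrite /hsum; case: xgetP => [t _ tF|/(_ s)//].
exact: has_hsum_unique tF sF.
Qed.

Lemma has_hsum_hsum (I : choiceType) (F : I -> X) :
  hcomplete -> hsummable F -> has_hsum F (hsum F).
Proof.
move=> cpl /cpl[s sF]; rewrite /hsum.
by case: xgetP => [t _ tF //|/(_ s)/(_ sF)].
Qed.

Lemma has_hsumP (I : choiceType) (F G : I -> X) c s t :
  has_hsum F s -> has_hsum G t ->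
  has_hsum (fun i => c *: F i + G i) (c *: s + t).
Proof.
move=> sF tG; apply: has_hsumI => M.
have [[A FA] [C GC]] := (has_hsum_summable sF M, has_hsum_summable tG M).
exists (A `|` C)%fset => [|i]; last first.
  by rewrite in_fsetU negb_or => /andP[/FA ? /GC ?]; exact: hdivP.
rewrite big_split /= -scaler_sumr opprD addrACA -scalerBr.
apply: hdivP; apply: has_hsum_tail => // i;
  by rewrite in_fsetU negb_or => /andP[/FA ? /GC ?].
Qed.

Lemma hsum_linear (I : choiceType) (F G : I -> X) c :
  hseparated -> hcomplete -> hsummable F -> hsummable G ->
  hsum (fun i => c *: F i + G i) = c *: hsum F + hsum G.
Proof.
by move=> sep cpl sF sG; apply: hsumE => //; apply: has_hsumP; exact: has_hsum_hsum.
Qed.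

(** Permits index shifts: n to n + 1 for multiplication by h, and n = k + j in the binomial
    formula. *)
Lemma has_hsum_reindex (I J : choiceType) (e : I -> J) (F : J -> X) s :
  injective e -> (forall j, (exists i, j = e i) \/ F j = 0) ->
  has_hsum (F \o e) s -> has_hsum F s.
Proof.
move=> einj Fe sF; apply: has_hsumI => M.
have [A FA] := has_hsum_summable sF M; exists (e @` A)%fset => [|j jA].
  by rewrite big_imfset /= => [|i i' _ _ /einj//]; exact: has_hsum_tail.
have [[i ij]|->] := Fe j; last exact: hdiv0.
by rewrite ij; apply: FA; apply: contra jA => iA; rewrite ij in_imfset.
Qed.

Lemma has_hsum1 (I : choiceType) (F : I -> X) i :
  (forall j, j != i -> F j = 0) -> has_hsum F (F i).
Proof.
move=> F0; apply: has_hsumI => M; exists [fset i]%fset => [|j].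
  by rewrite big_seq_fset1 subrr; exact: hdiv0.
by rewrite in_fset1 => /F0->; exact: hdiv0.
Qed.

Lemma htorsionfreeX M (x : X) : htorsionfree -> hvar ^+ M *: x = 0 -> x = 0.
Proof.
move=> tf; elim: M => [|M IH]; first by rewrite expr0 scale1r.
by rewrite exprS -scalerA => /tf.
Qed.
End HAdicSums.

(** A K[[h]]-linear map sends h^M X into h^M Y, so it is automatically continuous. This carries
    infinite sums through Y(z) and through the residue. *)
Lemma has_hsum_lin (K : comNzRingType) (X Y : lmodType (fps K))
    (f : {linear X -> Y}) (I : choiceType) (F : I -> X) s :
  has_hsum F s -> has_hsum (f \o F) (f s).
Proof.
move=> sF M; have [A sA] := sF M; exists A => C /sA.
by rewrite -linear_sum -linearB; exact: hdiv_lin.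
Qed.

Lemma hsummable_hpow (K : comNzRingType) (X : lmodType (fps K)) (t : nat -> X) :
  hsummable (fun n => hvar ^+ n *: t n).
Proof.
move=> M; exists (seq_fset tt (iota 0 M)) => n.
rewrite seq_fsetE mem_iota /= -leqNgt => Mn.
by apply: hdiv_le Mn _; exists (t n).
Qed.

(** * Formal series and topologically free modules *)

Section FormalSeries.
Variable K : comNzRingType.

Lemma fps_scaleE (W : lmodType K) (f : fps K) (v : fps W) n :
  (f *: v) n = \sum_(i < n.+1) f i *: v (n - i)%N.
Proof. by []. Qed.

Lemma hvar_scaleE (W : lmodType K) (v : fps W) n :
  (hvar *: v) n = if n is n'.+1 then v n' else 0.
Proof.
rewrite fps_scaleE big_ord_recl [hvar _]/hvar /= scale0r add0r.
case: n => [|n]; first by rewrite big_ord0.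
rewrite big_ord_recl big1 ?addr0 => [|i _].
  by rewrite /hvar /= scale1r /bump /= subSS subn0.
by rewrite /hvar /= scale0r.
Qed.

Lemma hvarX_scaleE (W : lmodType K) (v : fps W) M n :
  (hvar ^+ M *: v) n = if (n < M)%N then 0 else v (n - M)%N.
Proof.
elim: M n => [|M IH] n; first by rewrite expr0 scale1r subn0.
rewrite exprS -scalerA hvar_scaleE; case: n => [//|n].
by rewrite IH ltnS subSS.
Qed.

Lemma hcst_scaleE (W : lmodType K) c (v : fps W) n : (hcst c *: v) n = c *: v n.
Proof.
rewrite fps_scaleE big_ord_recl subn0 big1 ?addr0 // => i _.
by rewrite /hcst /= scale0r.
Qed.

Lemma fps_mulE_scale (f g : fps K) : f * g = f *: (g : fps K^o).
Proof. by []. Qed.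

Lemma hcstM (c d : K) : hcst (c * d) = hcst c * hcst d.
Proof.
apply: funext => n; rewrite fps_mulE_scale hcst_scaleE /hcst.
by case: (n == 0%N) => //; rewrite /= scaler0.
Qed.

Lemma hcst1 : hcst 1 = 1 :> fps K.
Proof. by apply: funext => -[]. Qed.

Lemma hcstD (c d : K) : hcst (c + d) = hcst c + hcst d.
Proof.
apply: funext => -[|n] //.
by rewrite -[RHS]/(0 + 0) addr0.
Qed.

Lemma hcst0 : hcst 0 = 0 :> fps K.
Proof. by apply: funext => -[]. Qed.

Lemma hcstN (c : K) : hcst (- c) = - hcst c.
Proof. by apply/eqP; rewrite -addr_eq0 -hcstD addNr hcst0. Qed.

Lemma hcst_sign n : hcst ((-1) ^+ n) = (-1) ^+ n :> fps K.
Proof.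
by elim: n => [|n IH]; rewrite ?expr0 ?hcst1 // !exprS hcstM IH hcstN hcst1.
Qed.

Lemma fps_split (f : fps K) : f = hcst (f 0%N) + hvar * (fun n => f n.+1).
Proof.
apply: funext => n.
rewrite -[RHS]/(hcst (f 0%N) n + (hvar *: ((fun n => f n.+1) : fps K^o)) n).
by rewrite hvar_scaleE; case: n => [|n]; rewrite /hcst /= ?addr0 ?add0r.
Qed.

Lemma hdiv_fpsP (W : lmodType K) M (x : fps W) :
  hdiv M x <-> forall n, (n < M)%N -> x n = 0.
Proof.
split=> [[y ->] n nM|x0]; first by rewrite hvarX_scaleE nM.
exists (fun n => x (n + M)%N); apply: funext => n; rewrite hvarX_scaleE.
by case: ltnP => [/x0|/subnK->].
Qed.

Lemma fps_sumE (W : lmodType K) (I : Type) (r : seq I) (F : I -> fps W) n :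
  (\sum_(i <- r) F i) n = \sum_(i <- r) F i n.
Proof. by elim/big_rec2: _ => // i x y _ <-. Qed.

Lemma fps_separated (W : lmodType K) : hseparated (fps W).
Proof. by move=> x x0; apply: funext => n; have /hdiv_fpsP := x0 n.+1; exact. Qed.

Lemma fps_torsionfree (W : lmodType K) : htorsionfree (fps W).
Proof.
move=> x hx; apply: funext => n.
by have := congr1 (fun v : fps W => v n.+1) hx; rewrite /= hvar_scaleE.
Qed.

Lemma fps_complete (W : lmodType K) : hcomplete (fps W).
Proof.
move=> I F sF; have [A FA] := choice sF.
(* Terms outside [A n.+1] vanish modulo h^(n+1), so this partial sum already has the final
   coefficient of h^n. *)
exists (fun n => \sum_(i <- A n.+1) F i n); apply: has_hsumI => M.
exists (A M); last exact: FA.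
apply/hdiv_fpsP => n nM.
rewrite -[LHS]/(\sum_(i <- A n.+1) F i n - (\sum_(i <- A M) F i) n) fps_sumE.
apply/eqP; rewrite subr_eq0; apply/eqP.
(* Both sums are extended to the union; the added terms are divisible by h^(n+1) or by h^M with n <
   M, so their coefficient of h^n is zero. *)
rewrite (big_fset_incl _ (fsubsetUl _ (A M))) => [|i _ /FA/hdiv_fpsP]; last exact.
rewrite [RHS](big_fset_incl _ (fsubsetUr (A n.+1) _)) // => i _ /FA/hdiv_fpsP.
exact.
Qed.

(* By induction on M, f = hcst (f 0) + hvar * f' propagates congruence mod h^M. *)
Lemma linear_fps (X Y : lmodType (fps K)) (p : X -> Y) :
  hseparated Y -> {morph p : x y / x + y} ->
  (forall c x, p (hcst c *: x) = hcst c *: p x) ->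
  (forall x, p (hvar *: x) = hvar *: p x) -> linear p.
Proof.
move=> sep pD pc ph f x y; rewrite pD; congr (_ + _); apply/eqP.
rewrite -subr_eq0; apply/eqP/sep => M.
elim: M f x {y} => [|M IH] f x.
  by exists (p (f *: x) - f *: p x); rewrite scale1r.
rewrite (fps_split f); set g : fps K := fun n => _.
rewrite !scalerDl pD pc -!scalerA ph opprD addrACA subrr add0r -scalerBr.
by have [u ->] := IH g x; exists u; rewrite scalerA -exprS.
Qed.
End FormalSeries.

(** * Transfer from W[[h]] to topologically free modules *)

Section TopFree.
Variables (K : comNzRingType) (V : topFree K).

Lemma tf_inv_linear : linear (@tf_inv _ V).
Proof.
by move=> c x y; apply: (can_inj (tf_isoK (t := V))); rewrite linearP !tf_invK.
Qed.
HB.instance Definition _ :=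
  GRing.isLinear.Build (fps K) (fps (tf_base V)) V *:%R (@tf_inv _ V) tf_inv_linear.

Lemma hdiv_tf_iso M (x : V) : hdiv M (tf_iso V x) <-> hdiv M x.
Proof.
split=> [xM|]; last exact: hdiv_lin.
by rewrite -[x](tf_isoK (t := V)); exact: hdiv_lin.
Qed.

Lemma topFree_separated : hseparated V.
Proof.
move=> x x0; apply: (can_inj (tf_isoK (t := V))); rewrite linear0.
by apply: fps_separated => M; apply/hdiv_tf_iso.
Qed.

Lemma topFree_torsionfree : htorsionfree V.
Proof.
move=> x hx; apply: (can_inj (tf_isoK (t := V))); rewrite linear0.
by apply: fps_torsionfree; rewrite -linearZ hx linear0.
Qed.

Lemma topFree_complete : hcomplete V.
Proof.
move=> I F sF; have [M|s sE] := @fps_complete _ _ I (tf_iso V \o F).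
  by have [A FA] := sF M; exists A => i /FA ?; apply/hdiv_tf_iso.
exists (tf_inv s); have := has_hsum_lin (@tf_inv _ V) sE.
by congr has_hsum; apply: funext => i /=; rewrite tf_isoK.
Qed.

Lemma tf_cst_hcst c (w : tf_base V) : tf_cst (c *: w) = hcst c *: tf_cst w.
Proof.
rewrite /tf_cst -linearZ; congr tf_inv; apply: funext => n; rewrite hcst_scaleE.
by case: (n == 0%N); rewrite ?scaler0.
Qed.

Lemma tf_cstD : {morph @tf_cst _ V : w w' / w + w'}.
Proof.
move=> w w'; rewrite /tf_cst -linearD; congr tf_inv; apply: funext => -[|n] //.
by rewrite -[RHS]/(0 + 0) addr0.
Qed.

Lemma tf_split (v : V) :
  v = tf_cst (tf_iso V v 0%N) + hvar *: tf_inv (fun n => tf_iso V v n.+1).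
Proof.
rewrite /tf_cst -linearZ -linearD -[LHS](tf_isoK (t := V)); congr tf_inv.
apply: funext => n.
rewrite -[RHS]/((if n == 0%N then _ else 0) + (hvar *: _ : fps _) n).
by rewrite hvar_scaleE; case: n => [|n]; rewrite /= ?addr0 ?add0r.
Qed.

(** Splitting off the constant term gives p(v) = h p(v'); iterating puts p(v) in every h^M X. Linear
    maps can thus be compared on constant series alone. *)
Lemma linear_tf_cst0 (X : lmodType (fps K)) (p : {linear V -> X}) :
  hseparated X -> (forall w, p (tf_cst w) = 0) -> forall v, p v = 0.
Proof.
move=> sep p0 v; apply: sep => M; elim: M v => [|M IH] v.
  by exists (p v); rewrite scale1r.
rewrite (tf_split v) linearD p0 add0r linearZ.
have [u ->] := IH (tf_inv (fun n => tf_iso V v n.+1)).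
by exists u; rewrite /= scalerA -exprS.
Qed.
End TopFree.

(** * V_h((z)) *)

Definition linear_of (R : pzRingType) (U V : lmodType R) (f : U -> V)
    (fL : linear f) : {linear U -> V} :=
  HB.pack f (GRing.isLinear.Build R U V *:%R f fL).

Section VLaurentTopology.
Variables (K : comNzRingType) (X : lmodType (fps K)).
Hypothesis tfX : htorsionfree X.

Lemma vlaurent_ext (f g : vlaurent X) : (forall m, f m = g m) -> f = g.
Proof. by move=> fg; apply: val_inj; apply: funext. Qed.

Lemma vlaurent_sumE (I : Type) (r : seq I) (F : I -> vlaurent X) m :
  (\sum_(i <- r) F i) m = \sum_(i <- r) F i m.
Proof. by elim/big_rec2: _ => // i x y _ <-. Qed.

Lemma hdiv_vlaurentP M (g : vlaurent X) : hdiv M g <-> forall m, hdiv M (g m).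
Proof.
split=> [[y ->] m|gM]; first by exists (y m).
have [y gy] := choice gM.
have yP : y \in @vlaurent_pred K X.
  (* The quotients [y] are chosen coefficient by coefficient, so they need a lower bound modulo
     h^M'. The bound of [g] modulo h^(M+M') gives one, after cancelling h^M by torsion-freeness. *)
  apply/asboolP => M'; have [N gN] := vlaurentP g (M + M'); exists N => m.
  move=> /gN[u gu]; exists u; apply/eqP; rewrite -subr_eq0; apply/eqP.
  apply: (@htorsionfreeX _ _ M) => //.
  by rewrite scalerBr -gy gu scalerA -exprD subrr.
by exists (VLaurent yP); apply: vlaurent_ext => m; rewrite gy.
Qed.

Lemma vlaurent_separated : hseparated X -> hseparated (vlaurent X).
Proof.
move=> sep g g0; apply: vlaurent_ext => m; apply: sep => M.
by have /hdiv_vlaurentP := g0 M.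
Qed.

(** Sums are taken in each power of z. Modulo h^M one finite partial sum approximates all
    coefficients at once, which bounds the poles of the limit. *)
Lemma vlaurent_complete : hcomplete X -> hcomplete (vlaurent X).
Proof.
move=> cpl I F sF.
have /choice[s sE] : forall m, exists t, has_hsum (fun i => F i m) t.
  move=> m; apply: cpl => M; have [A FA] := sF M; exists A => i /FA.
  by move/hdiv_vlaurentP.
have sP : s \in @vlaurent_pred K X.
  apply/asboolP => M; have [A FA] := sF M.
  have [N sN] := vlaurentP (\sum_(i <- A) F i) M; exists N => m /sN.
  rewrite vlaurent_sumE => Am; rewrite -[s m](subrK (\sum_(i <- A) F i m)).
  apply: hdivD => //; apply: has_hsum_tail => // i /FA/hdiv_vlaurentP.
  exact.
exists (VLaurent sP); apply: has_hsumI => M; have [A FA] := sF M; exists A => //.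
apply/hdiv_vlaurentP => m.
rewrite -[X in hdiv _ X]/(s m - (\sum_(i <- A) F i) m) vlaurent_sumE.
by apply: has_hsum_tail => // i /FA/hdiv_vlaurentP; exact.
Qed.
End VLaurentTopology.

(** * Tensor products *)

Section TensorLift.
Variables (K : comNzRingType) (U W : lmodType K) (X : lmodType (fps K)).
Variable b : U -> W -> X.
Hypotheses (bDl : forall w, {morph b^~ w : u u' / u + u'})
           (bDr : forall u, {morph b u : w w' / w + w'})
           (bZl : forall c u w, b (c *: u) w = hcst c *: b u w)
           (bZr : forall c u w, b u (c *: w) = hcst c *: b u w).

Local Notation F := {freeg (U * W)%type / K}.

(** The extension of [b] to the free module, before passing to the quotient; [tlift b t] is by
    conversion its value at the chosen representative of [t]. *)
Definition freeg_lift (x : F) : X :=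
  \sum_(p <- dom x) hcst (coeff p x) *: b p.1 p.2.

(** Coefficients vanish off the support, so several elements can be summed over one common index
    list. *)
Lemma freeg_liftE (x : F) (s : seq (U * W)) :
  uniq s -> {subset dom x <= s} ->
  freeg_lift x = \sum_(p <- s) hcst (coeff p x) *: b p.1 p.2.
Proof.
move=> us xs; rewrite /freeg_lift [RHS](bigID (mem (dom x))) /=.
rewrite [X in _ = _ + X]big1 ?addr0 => [|p /coeff_outdom->]; last first.
  by rewrite hcst0 scale0r.
rewrite -[RHS]big_filter; apply: perm_big; apply: uniq_perm.
- exact: uniq_dom.
- exact: filter_uniq.
- by move=> p; rewrite mem_filter andb_idr // => /xs.
Qed.

Lemma freeg_liftP c x y :
  freeg_lift (c *: x + y) = hcst c *: freeg_lift x + freeg_lift y.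
Proof.
pose s := undup (dom (c *: x + y) ++ dom x ++ dom y).
have us : uniq s by exact: undup_uniq.
rewrite !(@freeg_liftE _ s) // => [|p pd|p pd|p pd];
  rewrite ?mem_undup ?mem_cat ?pd ?orbT //.
rewrite scaler_sumr -big_split; apply: eq_bigr => p _ /=.
by rewrite coeffD coeffZ hcstD scalerDl hcstM scalerA.
Qed.

Lemma freeg_liftD x y : freeg_lift (x + y) = freeg_lift x + freeg_lift y.
Proof. by rewrite -[x]scale1r freeg_liftP hcst1 !scale1r. Qed.

Lemma freeg_lift0 : freeg_lift 0 = 0.
Proof. by apply: (@addrI _ (freeg_lift 0)); rewrite -freeg_liftD !addr0. Qed.

Lemma freeg_liftZ c x : freeg_lift (c *: x) = hcst c *: freeg_lift x.
Proof. by rewrite -[c *: x]addr0 freeg_liftP freeg_lift0 addr0. Qed.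

Lemma freeg_liftB x y : freeg_lift (x - y) = freeg_lift x - freeg_lift y.
Proof.
by apply/eqP; rewrite eq_sym subr_eq -freeg_liftD subrK.
Qed.

Lemma freeg_lift_tgen u w : freeg_lift (tgen u w) = b u w.
Proof.
rewrite (@freeg_liftE _ [:: (u, w)]) => [|//|p].
  by rewrite big_seq1 coeffU eqxx mulr1 hcst1 scale1r.
by rewrite domU1.
Qed.

Lemma freeg_lift_null x : tnull x -> freeg_lift x = 0.
Proof.
elim=> [|c y z _ y0 _ z0|u u' w|u w w'|c u w|c u w].
- exact: freeg_lift0.
- by rewrite freeg_liftP y0 z0 scaler0 addr0.
- by rewrite !freeg_liftB !freeg_lift_tgen bDl addrAC addrK subrr.
- by rewrite !freeg_liftB !freeg_lift_tgen bDr addrAC addrK subrr.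
- by rewrite freeg_liftB freeg_liftZ !freeg_lift_tgen bZl subrr.
- by rewrite freeg_liftB freeg_liftZ !freeg_lift_tgen bZr subrr.
Qed.

(** Independence of the representative: two representatives differ by a null element, which
    bilinearity of [b] kills. *)
Lemma tlift_class x : tlift b (tens_class x) = freeg_lift x.
Proof.
apply/eqP; rewrite -subr_eq0 -[tlift _ _]/(freeg_lift _) -freeg_liftB.
by apply/eqP/freeg_lift_null/tens_classP; exact: tens_reprK.
Qed.

Lemma tliftD : {morph tlift b : s t / s + t}.
Proof.
move=> s t; rewrite -[s]tens_reprK -[t]tens_reprK -raddfD !tlift_class.
exact: freeg_liftD.
Qed.

Lemma tliftZ c t : tlift b (c *: t) = hcst c *: tlift b t.
Proof.
rewrite -[t]tens_reprK -[_ *: tens_class _]/(tens_scale _ _) tens_scaleE.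
by rewrite !tlift_class freeg_liftZ.
Qed.

Lemma tlift_pure u w : tlift b (tpure u w) = b u w.
Proof. by rewrite tlift_class freeg_lift_tgen. Qed.
End TensorLift.

Section PureTensors.
Variables (K : comNzRingType) (U W : lmodType K).

Lemma tpureDl w : {morph (@tpure K U W)^~ w : u u' / u + u'}.
Proof.
move=> u u'; rewrite /tpure -raddfD; apply/tens_classP.
by rewrite opprD addrA; exact: tnullDl.
Qed.

Lemma tpureDr u : {morph @tpure K U W u : w w' / w + w'}.
Proof.
move=> w w'; rewrite /tpure -raddfD; apply/tens_classP.
by rewrite opprD addrA; exact: tnullDr.
Qed.

Lemma tpureZl c (u : U) (w : W) : tpure (c *: u) w = c *: tpure u w.
Proof.
by rewrite -[RHS]/(tens_scale _ _) tens_scaleE; apply/tens_classP; exact: tnullZl.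
Qed.

Lemma tpureZr c (u : U) (w : W) : tpure u (c *: w) = c *: tpure u w.
Proof.
by rewrite -[RHS]/(tens_scale _ _) tens_scaleE; apply/tens_classP; exact: tnullZr.
Qed.

Lemma tpure0l (w : W) : tpure (0 : U) w = 0.
Proof. by rewrite -(scale0r 0) tpureZl scale0r. Qed.

Lemma tpure0r (u : U) : tpure u (0 : W) = 0.
Proof. by rewrite -(scale0r 0) tpureZr scale0r. Qed.
End PureTensors.

(** * The completed tensor product and its universal property *)

Section CompletedTensor.
Variables (K : comNzRingType) (U V : topFree K).

Lemma ctpure_linearl (v : V) : linear (fun u : U => u ⊗ v).
Proof.
apply: linear_fps; first exact: topFree_separated.
- move=> u u'; apply: funext => n.
  rewrite -[RHS]/((u ⊗ v) n + (u' ⊗ v) n) /ctpure -big_split /=.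
  by apply: eq_bigr => i _; rewrite -tpureDl linearD.
- move=> c u; apply: funext => n; rewrite [RHS]hcst_scaleE scaler_sumr.
  by apply: eq_bigr => i _; rewrite linearZ /= hcst_scaleE tpureZl.
- move=> u; apply: funext => n; rewrite [RHS]hvar_scaleE /ctpure.
  (* With the left factor multiplied by h, the term i = 0 vanishes and the others shift by one. *)
  rewrite big_ord_recl linearZ /= hvar_scaleE tpure0l add0r.
  case: n => [|n]; first by rewrite big_ord0.
  by apply: eq_bigr => i _; rewrite hvar_scaleE /= subSS.
Qed.

Lemma ctpure_linearr (u : U) : linear (fun v : V => u ⊗ v).
Proof.
apply: linear_fps; first exact: topFree_separated.
- move=> v v'; apply: funext => n.
  rewrite -[RHS]/((u ⊗ v) n + (u ⊗ v') n) /ctpure -big_split /=.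
  by apply: eq_bigr => i _; rewrite -tpureDr linearD.
- move=> c v; apply: funext => n; rewrite [RHS]hcst_scaleE scaler_sumr.
  by apply: eq_bigr => i _; rewrite linearZ /= hcst_scaleE tpureZr.
- move=> v; apply: funext => n; rewrite [RHS]hvar_scaleE /ctpure.
  (* Here the last term i = n vanishes instead, since its right factor has index 0. *)
  rewrite big_ord_recr linearZ /= subnn hvar_scaleE tpure0r addr0.
  case: n => [|n]; first by rewrite big_ord0.
  by apply: eq_bigr => i _; rewrite hvar_scaleE subSn // -ltnS.
Qed.

Lemma ctpure_cst (u : tf_base U) (w : tf_base V) :
  (tf_cst u : U) ⊗ (tf_cst w : V) = (tf_cst (tpure u w : tf_base (ctens U V)) : ctens U V).
Proof.
apply: funext => n; rewrite /ctpure /tf_cst !tf_invK /=.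
rewrite big_ord_recl subn0 big1 ?addr0 => [|i _]; last exact: tpure0l.
by case: (n == 0%N); rewrite ?tpure0r.
Qed.

Section CLift.
Variables (X : lmodType (fps K)) (sepX : hseparated X) (cplX : hcomplete X).
Variable b : U -> V -> X.
Hypotheses (bl : forall v, linear (b^~ v)) (br : forall u, linear (b u)).

Let b0 (u : tf_base U) (w : tf_base V) := b (tf_cst u) (tf_cst w).

Let b0Dl w : {morph b0^~ w : u u' / u + u'}.
Proof. by move=> u u'; rewrite /b0 tf_cstD; exact: (linearD (linear_of (bl _))). Qed.
Let b0Dr u : {morph b0 u : w w' / w + w'}.
Proof. by move=> w w'; rewrite /b0 tf_cstD; exact: (linearD (linear_of (br _))). Qed.
Let b0Zl c u w : b0 (c *: u) w = hcst c *: b0 u w.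
Proof. by rewrite /b0 tf_cst_hcst; exact: (linearZ_LR (linear_of (bl _))). Qed.
Let b0Zr c u w : b0 u (c *: w) = hcst c *: b0 u w.
Proof. by rewrite /b0 tf_cst_hcst; exact: (linearZ_LR (linear_of (br _))). Qed.

Let tbD := tliftD b0Dl b0Dr b0Zl b0Zr.
Let tbZ := tliftZ b0Dl b0Dr b0Zl b0Zr.
Let tbP := tlift_pure b0Dl b0Dr b0Zl b0Zr.

(** The powers of h make the defining family summable, so completeness of X rules out the default
    value of [hsum]. *)
Lemma has_hsum_clift (x : U ^⊗ V) :
  has_hsum (fun n => hvar ^+ n *: tlift b0 (x n)) (clift b x).
Proof. by apply: has_hsum_hsum => //; exact: hsummable_hpow. Qed.

Lemma clift_linear : linear (clift b).
Proof.
apply: linear_fps => //.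
- move=> x y; apply: hsumE => //.
  have := has_hsumP 1 (has_hsum_clift x) (has_hsum_clift y); rewrite scale1r.
  congr has_hsum; apply: funext => n.
  by rewrite scale1r -scalerDr -tbD.
- move=> c x; apply: hsumE => //.
  have := has_hsum_lin (hcst c \*: idfun) (has_hsum_clift x).
  congr has_hsum; apply: funext => n /=.
  by rewrite hcst_scaleE tbZ !scalerA mulrC.
- move=> x; apply: hsumE => //.
  (* Multiplication by h shifts the family by one index; its new term at 0 is zero. *)
  apply: (has_hsum_reindex succn_inj) => [[|n]|].
  + right; rewrite hvar_scaleE -(scale0r 0) tbZ hcst0 scale0r scaler0 //.
  + by left; exists n.
  have := has_hsum_lin (hvar \*: idfun) (has_hsum_clift x).
  congr has_hsum; apply: funext => n /=.
  by rewrite hvar_scaleE scalerA -exprS.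
Qed.

(** Checked first on two constants, where only the coefficient of h^0 contributes, then extended by
    linearity and [linear_tf_cst0] to the right factor and finally to the left. *)
Lemma clift_pure u v : clift b (u ⊗ v) = b u v.
Proof.
have cst u0 w0 : clift b ((tf_cst u0 : U) ⊗ (tf_cst w0 : V)) = b (tf_cst u0) (tf_cst w0).
  rewrite ctpure_cst; apply: hsumE => //.
  have := @has_hsum1 _ _ _ (fun n => hvar ^+ n *:
    tlift b0 ((tf_cst (tpure u0 w0 : tf_base (ctens U V)) : ctens U V) n)) 0%N.
  rewrite expr0 scale1r tbP; apply => -[//|n] _.
  by rewrite -[X in tlift b0 X]/(0 : tens _ _) -(scale0r 0) tbZ hcst0 scale0r scaler0.
have half u0 : forall v, clift b ((tf_cst u0 : U) ⊗ v) = b (tf_cst u0) v.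
  pose p v := clift b ((tf_cst u0 : U) ⊗ v) - b (tf_cst u0) v.
  have pL : linear p.
    move=> c x y; rewrite /p ctpure_linearr clift_linear br.
    by rewrite opprD addrACA scalerBr.
  move=> w; apply/eqP; rewrite -subr_eq0; apply/eqP.
  by apply: (linear_tf_cst0 (p := linear_of pL)) => // w0; rewrite /= /p cst subrr.
pose p u := clift b (u ⊗ v) - b u v.
have pL : linear p.
  move=> c x y; rewrite /p (ctpure_linearl v) clift_linear bl.
  by rewrite opprD addrACA scalerBr.
apply/eqP; rewrite -subr_eq0; apply/eqP.
by apply: (linear_tf_cst0 (p := linear_of pL)) => // w0; rewrite /= /p half subrr.
Qed.
End CLift.
End CompletedTensor.

(** * Operations on V_h((z)) *)

Section Operations.
Variables (K : fieldType) (V : topFree K).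
Implicit Types (g : vlaurent V) (f : hlaurent K).

Let sepV := @topFree_separated K V.
Let cplV := @topFree_complete K V.

(** Modulo h^M only finitely many Laurent series occur in [f], and the minimum of their lower bounds
    serves for all. *)
Lemma zcoef_hdiv f M : exists N : int, forall j, j < N ->
  exists u, zcoef f j = hvar ^+ M * u.
Proof.
suff [N fN] : exists N : int, forall j, j < N -> forall n, (n < M)%N -> zcoef f j n = 0.
  by exists N => j /fN/fps_hdiv.
elim: M => [|M [N IH]]; first by exists 0.
have /asboolP[N' fN'] := valP (f M : laurent K).
exists (Num.min N N') => j; rewrite lt_min => /andP[jN jN'] n.
by rewrite ltnS leq_eqVlt => /predU1P[->|nM]; [exact: fN'|exact: IH].
Qed.

Lemma zcoef_linear c f f' j : zcoef (c *: f + f') j = c * zcoef f j + zcoef f' j.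
Proof.
apply: funext => n; rewrite /zcoef.
rewrite -[(c *: f + f') n]/((c *: f) n + f' n) fps_scaleE.
rewrite -[RHS]/(\sum_(i < n.+1) c i * (f (n - i)%N : laurent K) j +
  (f' n : laurent K) j); congr (_ + _).
by elim/big_rec2: _ => // i x y _ <-.
Qed.

Lemma vl_mul_summable f g (m : int) : hsummable (fun j : int => zcoef f j *: g (m - j)).
Proof.
move=> M; have [[N fN] [N' gN']] := (zcoef_hdiv f M, vlaurentP g M).
(* Modulo h^M only N <= j <= m - N' matters: below N the coefficient of [f] is divisible, above m -
   N' that of [g] is. *)
exists (seq_fset tt [seq N + k%:Z | k <- iota 0 (absz (m - N' - N)%R).+1]) => j.
rewrite seq_fsetE => jA; have [/fN[u ->]|Nj] := ltP j N.
  by exists (u *: g (m - j)); rewrite scalerA.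
apply/hdivZ/gN'; rewrite ltNge; apply: contra jA => N'mj.
apply/mapP; exists (absz (j - N)%R); last by lia.
by rewrite mem_iota; lia.
Qed.

Lemma vl_mul_linearl g : linear (fun f => vl_mul f g).
Proof.
move=> c f f'; apply: vlaurent_ext => m.
rewrite -[RHS]/(c *: hsum _ + hsum _) -hsum_linear //; try exact: vl_mul_summable.
congr hsum; apply: funext => j.
by rewrite zcoef_linear scalerDl scalerA.
Qed.

Lemma vl_mul_linearr f : linear (fun g => vl_mul f g).
Proof.
move=> c g g'; apply: vlaurent_ext => m.
rewrite -[RHS]/(c *: hsum _ + hsum _) -hsum_linear //; try exact: vl_mul_summable.
congr hsum; apply: funext => j.
by rewrite -[(c *: g + g') _]/(c *: g _ + g' _) scalerDr !scalerA mulrC.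
Qed.

Lemma vl_mul1 g : vl_mul (hlaurent1 K) g = g.
Proof.
apply: vlaurent_ext => m; apply: hsumE => //.
have z1 j : zcoef (hlaurent1 K) j = (j == 0)%:R.
  by apply: funext => -[|n]; rewrite /zcoef /=; case: (j == 0).
have := @has_hsum1 _ V _ (fun j : int => zcoef (hlaurent1 K) j *: g (m - j)) 0.
rewrite z1 scale1r subr0; apply => j /negPf j0.
by rewrite z1 j0 scale0r.
Qed.

Lemma iter_linearZ (T : {linear V -> V}) n c x : iter n T (c *: x) = c *: iter n T x.
Proof. by elim: n => //= n ->; rewrite linearZ. Qed.

Lemma lres_linear : linear (@lres K V).
Proof.
move=> c g g'; apply: val_inj; apply: funext => n.
rewrite -[RHS]/(c *: (hcst _ *: g _) + hcst _ *: g' _).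
rewrite -[LHS]/(hcst _ *: (c *: g _ + g' _)).
by rewrite scalerDr !scalerA mulrC.
Qed.

Lemma vl_exp_summable (T : {linear V -> V}) g m :
  hsummable (fun k : nat => hcst (k`!%:R^-1 : K) *: iter k T (g (m - k%:Z))).
Proof.
move=> M; have [N gN] := vlaurentP g M.
exists (seq_fset tt (iota 0 (absz (m - N)%R).+1)) => k.
rewrite seq_fsetE mem_iota => kA.
apply/hdivZ/hdiv_iter/gN; lia.
Qed.

(** Characteristic zero makes the binomial coefficient invertible, so it cancels against its
    occurrence in (k+j)! = C(k+j,k) k! j!. *)
Lemma bin_div_fact k j : [pchar K] =i pred0 ->
  'C(k + j, k)%:R / (k + j)`!%:R = k`!%:R^-1 * j`!%:R^-1 :> K.
Proof.
move=> charK0.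
have bin_neq0 : 'C(k + j, k)%:R != 0 :> K.
  by rewrite ((pcharf0P _).1 charK0) -lt0n bin_gt0 leq_addr.
rewrite -(bin_fact (leq_addr j k)) addKn !natrM !invfM mulrA divff //.
by rewrite mul1r.
Qed.

(** The binomial theorem on the coefficient of lambda^k: (1/k!)(1/j!) T^j from the two exponentials
    matches C(n,k)/n! T^(n-k) at n = k + j. *)
Lemma lres_exp_opp (T : {linear V -> V}) g : [pchar K] =i pred0 ->
  lres (vl_exp T (vl_opp g)) = - vp_subst T (lres g).
Proof.
move=> charK0; apply: val_inj; apply: funext => k.
apply/eqP; rewrite eq_sym -[X in X == _]/(- hsum _) eqr_oppLR; apply/eqP.
apply: hsumE => //.
(* Substitute n = k + j; the terms with n < k drop out because their binomial coefficient is
   zero. *)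
apply: (has_hsum_reindex (@addnI k)) => [n|].
  have [kn|nk] := leqP k n; first by left; exists (n - k)%N; rewrite subnKC.
  by right; rewrite bin_small // mulr0 hcst0 scale0r.
have := has_hsum_lin (- hcst (k`!%:R^-1 : K) \*: idfun)
  (has_hsum_hsum cplV (vl_exp_summable T (vl_opp g) (- k.+1%:Z))).
rewrite /= scaleNr; congr has_hsum; apply: funext => j /=.
(* The exponent -(k+j+1) gives g(-z) the sign (-1)^(k+j+1), one factor -1 more than (-lambda-T)^n
   supplies; the scaling by -1/k! compensates for it. *)
rewrite addKn (_ : - k.+1%:Z - j%:Z = - (k + j).+1%:Z); last by lia.
rewrite abszN absz_nat -hcst_sign !iter_linearZ !scalerA -hcstN -!hcstM.
congr (hcst _ *: _).
by rewrite -[RHS]mulrA bin_div_fact // exprS; ring.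
Qed.
End Operations.

(** * The flip and the extension of Y(z) on pure tensors *)

Section ExtensionOfY.
Variables (K : fieldType) (V : topFree K) (B : braided_sfc V).

Lemma ctswap_pure (u v : V) : ctswap (u ⊗ v) = v ⊗ u.
Proof.
apply: clift_pure; [exact: topFree_separated|exact: topFree_complete| |].
- by move=> w; exact: ctpure_linearr.
- by move=> w; exact: ctpure_linearl.
Qed.

Let sepVL : hseparated (vlaurent V).
Proof.
by apply: vlaurent_separated; [exact: topFree_torsionfree|exact: topFree_separated].
Qed.

Let cplVL : hcomplete (vlaurent V).
Proof.
by apply: vlaurent_complete;
  [exact: topFree_torsionfree|exact: topFree_complete].
Qed.

Let YextL x : linear (fun f => vl_mul f (bsf_Y B x)) := vl_mul_linearl (bsf_Y B x).

Let YextR f : linear (fun x => vl_mul f (bsf_Y B x)).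
Proof. by move=> c x y; rewrite linearP; exact: vl_mul_linearr. Qed.

Lemma bsf_Yext_linear : linear (bsf_Yext B).
Proof. exact: clift_linear. Qed.

Lemma bsf_Yext_pure (x : V ^⊗ V) f : bsf_Yext B (x ⊗ f) = vl_mul f (bsf_Y B x).
Proof. exact: clift_pure. Qed.
End ExtensionOfY.

Theorem proposition8 (K : fieldType) (charK0 : [pchar K] =i pred0)
    (V : topFree K) (B : braided_sfc V)
    (hYS : forall x : V ^⊗ V, bsf_Yext B (bsf_S B x) = bsf_Yop B x)
    (a b : V) (I : choiceType) (a_ b_ : I -> V) (f_ : I -> hlaurent K)
    (hS : has_hsum (fun i => a_ i ⊗ b_ i ⊗ f_ i) (bsf_S B (a ⊗ b))) :
  has_hsum (fun i => lfprod B (f_ i) (a_ i) (b_ i))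
    (- vp_subst (bsf_T B) (lprod B b a)).
Proof.
(* The expansion of S(z)(a ⊗ b) is pushed through the extended Y(z) and then through the residue,
   both continuous by linearity. *)
have := has_hsum_lin (linear_of (@lres_linear K V))
  (has_hsum_lin (linear_of (bsf_Yext_linear B)) hS).
(* The limit becomes the residue of Y^op; [vl_mul1] removes the factor f = 1 from the definition of
   the lambda-product. *)
rewrite /= hYS /bsf_Yop ctswap_pure lres_exp_opp // /lprod /lfprod vl_mul1.
by congr has_hsum; apply: funext => i /=; rewrite bsf_Yext_pure.
Qed.
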